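(* Let $G$ be a group and let $A$ be a finite set. Then every strongly irreducible subshift $X \subset A^G$ is topologically mixing.
   Context: $A^G$ is the set of all maps $x \colon G \to A$ with the product of the discrete topologies; $G$ acts by $(gx)(h) = x(g^{-1}h)$. A subshift is a closed $G$-invariant subset. For $\Omega,\Delta \subset G$ put $\Omega^{+\Delta} = \{g \in G : g\Delta \cap \Omega \neq \varnothing\} = \Omega\Delta^{-1}$. A subshift $X$ is strongly irreducible if there is a finite $\Delta \subset G$ such that for all finite $\Omega_1,\Omega_2 \subset G$ with $\Omega_1^{+\Delta} \cap \Omega_2 = \varnothing$ and all $x_1,x_2 \in X$ there is $x \in X$ coinciding with $x_1$ on $\Omega_1$ and with $x_2$ on $\Omega_2$. A subshift $X$ is topologically mixing if for any nonempty open subsets $U,V$ of $X$ there is a finite subset $F \subset G$ such that $U \cap gV \neq \varnothing$ for all $g \in G\setminus F$. *)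

(* Defs.v *)
From HB Require Import structures.
From mathcomp Require Import all_boot all_order all_algebra.
From mathcomp Require Import all_classical all_reals all_analysis.
Set Implicit Arguments.
Unset Strict Implicit.
Unset Printing Implicit Defensive.
Local Open Scope classical_set_scope.

(* A notation rather than a definition, so that the topological structure of
   the product of discrete spaces is inferred. *)
Notation config G A := {ptws G -> discrete_topology A}.

Definition shift (G : groupType) (A : finType) (g : G) (x : config G A)
  : config G A := fun h => x (g^-1 * h)%g.

Definition subshift (G : groupType) (A : finType) (X : set (config G A)) :=
  closed X /\ forall g : G, shift g @` X `<=` X.

Definition thickening (G : groupType) (Delta Omega : set G) : set G :=
  [set g | [set (g * d)%g | d in Delta] `&` Omega !=set0].

Definition strongly_irreducible (G : groupType) (A : finType)
    (X : set (config G A)) :=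
  exists2 Delta : set G, finite_set Delta &
    forall Omega1 Omega2 : set G, finite_set Omega1 -> finite_set Omega2 ->
      thickening Delta Omega1 `&` Omega2 = set0 ->
    forall x1 x2 : config G A, X x1 -> X x2 ->
    exists x : config G A, [/\ X x,
      forall h, Omega1 h -> x h = x1 h &
      forall h, Omega2 h -> x h = x2 h].

(* The topology of [subspace X] agrees with the induced topology of X only
   inside X (points outside X are isolated), hence the inclusions in X. *)
Definition topologically_mixing (G : groupType) (A : finType)
    (X : set (config G A)) :=
  forall U V : set (config G A), U `<=` X -> V `<=` X ->
    open (U : set (subspace X)) -> open (V : set (subspace X)) ->
    U !=set0 -> V !=set0 ->
  exists2 F : set G, finite_set F &
    forall g : G, ~ F g -> U `&` shift g @` V !=set0.

(* Main.v *)
(** Open sets of a product of discrete spaces contain cylinders over finite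
    sets.  Given points [u] of [U] and [v] of [V] with such cylinders over
    [P] and [Q], strong irreducibility glues [u] on [P] to the translate of
    [v] by [g] on [g Q] as soon as the [Delta]-thickening of [P] misses [g Q];
    this excludes only the finitely many [g] in [P Delta^-1 Q^-1]. *)
Require Import Defs.
From HB Require Import structures.
From mathcomp Require Import all_boot all_order all_algebra.
From mathcomp Require Import all_classical all_reals all_analysis.

Local Open Scope classical_set_scope.

(** The conclusion says that [U] lies in the filter [F] generated by the cylinders at [x], so it
    suffices that [F] converges to [x]. The product topology being a supremum, this is checked one
    coordinate at a time. *)
Lemma nbhs_cylinder (I : Type) (A : choiceType)
    (x : {ptws I -> discrete_topology A}) (U : set {ptws I -> discrete_topology A}) :
  nbhs x U ->
  exists2 P : set I, finite_set P &
    forall y : {ptws I -> discrete_topology A},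
      (forall i, P i -> y i = x i) -> U y.
Proof.
pose cyl (P : set I) := [set y : {ptws I -> discrete_topology A} |
  forall i, P i -> y i = x i].
pose F := filter_from finite_set cyl.
have FF : Filter F.
  apply: filter_from_filter; first by exists set0.
  move=> P Q finP finQ; exists (P `|` Q); first by rewrite finite_setU.
  by move=> y yPQ; split=> i Pi; apply: yPQ; [left|right].
suff Fx : F --> x by move=> /Fx.
apply/cvg_sup => i W /=; rewrite nbhs_simpl => -[_ [[B _ <-] Bx BW]].
(* [W] constrains only the value at [i]. *)
exists [set i]; first exact: finite_set1.
by move=> y yx; apply: BW => /=; rewrite yx.
Qed.

Lemma open_subspace_cylinder {G : groupType} {A : finType}
    {X U : set (config G A)} {x : config G A} :
  U `<=` X -> open (U : set (subspace X)) -> U x ->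
  exists2 P : set G, finite_set P &
    forall y : config G A, X y -> (forall h, P h -> y h = x h) -> U y.
Proof.
move=> UX Uo Ux; have /nbhs_subspace_ex : nbhs (x : subspace X) U.
  by apply: open_nbhs_nbhs.
move=> /(_ (UX _ Ux)) [V /nbhs_cylinder[P finP PV] UV].
exists P => // y Xy yx; have [] : (U `&` X) y by rewrite UV; split; [exact: PV|].
by [].
Qed.

Lemma finite_thickening_meets_translate {G : groupType} {Delta P Q : set G} :
  finite_set Delta -> finite_set P -> finite_set Q ->
  finite_set [set g | thickening Delta P `&` [set (g * q)%g | q in Q] !=set0].
Proof.
move=> finD finP finQ.
(* A common point [g * q] satisfies [g * q * d = p], which forces [g = p * d^-1 * q^-1]. *)
apply: (@sub_finite_set _ _
  [set (a * q^-1)%g | a in [set (p * d^-1)%g | p in P & d in Delta] & q in Q]).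
  move=> g [k [[p [[d Dd gd] Pp]] [q Qq gq]]].
  exists (g * q)%g; last by exists q => //; rewrite mulgK.
  by exists p => //; exists d => //; rewrite -gd -gq mulgK.
by do 2?apply: finite_image2.
Qed.

Theorem proposition3p3 (G : groupType) (A : finType) (X : set (config G A)) :
  subshift X -> strongly_irreducible X -> topologically_mixing X.
Proof.
move=> [_ shX] [Delta finD irrX] U V UX VX Uo Vo [u Uu] [v Vv].
have [P finP PU] := open_subspace_cylinder UX Uo Uu.
have [Q finQ QV] := open_subspace_cylinder VX Vo Vv.
eexists; first exact: (finite_thickening_meets_translate finD finP finQ).
move=> g /= /set0P/negP/negPn/eqP disj.
have shiftX h z : X z -> X (Defs.shift h z) by move=> Xz; apply: (shX h); exists z.
have [x [Xx xu xv]] := irrX _ _ finP (finite_image _ finQ) disj _ _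
  (UX _ Uu) (shiftX g _ (VX _ Vv)).
exists x; split; first exact: PU.
(* Since [x] agrees with the translate of [v] by [g] on [g Q], shifting it back agrees with [v] on
   [Q]. *)
exists (Defs.shift g^-1%g x).
  apply: QV; first exact: shiftX.
  move=> h Qh; rewrite /Defs.shift invgK xv; first by rewrite /Defs.shift mulKg.
  by exists h.
by apply/funext => h; rewrite /Defs.shift invgK mulVKg.
Qed.
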